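(* Let $q\ge 4$ be a power of $2$, and let $W$ be the four-dimensional $\mathbb{F}_q$-space of all polynomials $a_{11}Y_1^2+a_{13}Y_1+a_{23}Y_2+a_{33}$ with $a_{11},a_{13},a_{23},a_{33}\in\mathbb{F}_q$. The reduced generalized Datta-Johnsen code arising from $W$ is a $\left[\tfrac12 q(q-1),\,4,\,\tfrac12 q(q-3)\right]_q$ linear code, and the set of weights of its non-zero codewords is $$\left\{\tfrac12 q(q-3),\ \tfrac12(q^2-3q+2),\ \tfrac12 q^2-q,\ \tfrac12 q^2-q+1,\ \tfrac12 q(q-1)\right\}.$$
   Context: A distinguished point of $\mathbb{F}_q^2$ is a point $(x_1,x_2)$ with $x_1\neq x_2$. Two distinguished points are equivalent if they have the same coordinates up to order; let $\mathcal{Q}$ be an ordered set of representatives of the equivalence classes, so $|\mathcal{Q}|=\tfrac12 q(q-1)$. Let $W$ be an $\mathbb{F}_q$-linear subspace of the space of polynomials of degree at most $2$ in $\mathbb{F}_q[Y_1,Y_2]$. To $f\in W$ associate the symmetric polynomial $\Phi_2(f)(X_1,X_2)=f(X_1+X_2,X_1X_2)$. The reduced generalized Datta-Johnsen code arising from $W$ is the linear code $\{(\Phi_2(f)(P))_{P\in\mathcal{Q}} : f\in W\}\subseteq \mathbb{F}_q^{\,q(q-1)/2}$. An $[n,k,d]_q$ code is a linear code over $\mathbb{F}_q$ of length $n$, dimension $k$ and minimum Hamming distance $d$. The weight of a codeword is the number of its non-zero coordinates. *)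

(* Defs.v *)
From HB Require Import structures.
From mathcomp Require Import all_boot all_order all_algebra.
From mathcomp Require Import mpoly ring.

Set Implicit Arguments.
Unset Strict Implicit.
Unset Printing Implicit Defensive.

Import GRing.Theory.
Local Open Scope ring_scope.

Section HammingMetric.
Variables (F : finFieldType) (n : nat).
Implicit Types (c : 'rV[F]_n) (C : 'rV[F]_n -> Prop).

Definition weight c : nat := #|[set i | c 0 i != 0]|.

Definition hamming_dist c c' : nat := #|[set i | c 0 i != c' 0 i]|.

Definition is_min_distance C (d : nat) : Prop :=
  (exists c c', [/\ C c, C c', c <> c' & hamming_dist c c' = d]) /\
  (forall c c', C c -> C c' -> c <> c' -> (d <= hamming_dist c c')%N).

(* [C] is an [N, k, d] code over [F]; linearity is the existence of the
   subspace [V] having the same elements as [C]. *)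
Definition is_linear_code C (N k d : nat) : Prop :=
  [/\ n = N,
      exists V : {vspace 'rV[F]_n},
        (forall c, c \in V <-> C c) /\ \dim V = k
    & is_min_distance C d].

Definition is_nonzero_weight C (w : nat) : Prop :=
  exists c, [/\ C c, c <> 0 & weight c = w].

End HammingMetric.

Section DattaJohnsen.
Variable F : finFieldType.

(* A point (x_1, x_2) is a pair [P] with x_1 = [tnth P 0], x_2 = [tnth P 1]. *)
Definition point := 2.-tuple F.

Definition distinguished (P : point) : bool := tnth P 0 != tnth P 1.

(* [perm_eq] is equality of coordinates up to order; uniqueness of the index
   makes the entries of [Q] pairwise inequivalent. *)
Definition is_representatives (n : nat) (Q : n.-tuple point) : Prop :=
  (forall i, distinguished (tnth Q i)) /\
  (forall P, distinguished P -> exists! i, perm_eq P (tnth Q i)).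

(* Linear subspaces of the polynomials of total degree at most 2; [msize] is
   one more than the total degree. The variables Y_1, Y_2 are 'X_0, 'X_1. *)
Record quadratic_space := QuadraticSpace {
  in_space :> {mpoly F[2]} -> Prop;
  in_space0 : in_space 0;
  in_spaceP : forall (a : F) f g,
    in_space f -> in_space g -> in_space (a *: f + g);
  in_space_deg : forall f, in_space f -> (msize f <= 3)%N
}.

Definition Phi2 (f : {mpoly F[2]}) : {mpoly F[2]} :=
  f \mPo [tuple 'X_0 + 'X_1; 'X_0 * 'X_1].

Definition eval_word (n : nat) (Q : n.-tuple point) (f : {mpoly F[2]}) :
    'rV[F]_n :=
  \row_(i < n) (Phi2 f).@[tnth (tnth Q i)].

Definition reduced_DJ_code (W : quadratic_space) (n : nat)
    (Q : n.-tuple point) (c : 'rV[F]_n) : Prop :=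
  exists2 f, W f & c = eval_word Q f.

Definition Wpoly (a11 a13 a23 a33 : F) : {mpoly F[2]} :=
  a11 *: 'X_0 ^+ 2 + a13 *: 'X_0 + a23 *: 'X_1 + a33%:MP.

Lemma Wpoly_lin (a a11 a13 a23 a33 b11 b13 b23 b33 : F) :
  a *: Wpoly a11 a13 a23 a33 + Wpoly b11 b13 b23 b33 =
  Wpoly (a * a11 + b11) (a * a13 + b13) (a * a23 + b23) (a * a33 + b33).
Proof. by rewrite /Wpoly -!mul_mpolyC !mpolyCD !mpolyCM; ring. Qed.

(* The four parameters are coordinates: the space [W] has dimension 4. *)
Lemma Wpoly_inj (a11 a13 a23 a33 b11 b13 b23 b33 : F) :
  Wpoly a11 a13 a23 a33 = Wpoly b11 b13 b23 b33 ->
  [/\ a11 = b11, a13 = b13, a23 = b23 & a33 = b33].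
Proof.
move=> eqW; have coefW m := congr1 (mcoeff m) eqW.
have mE (m m' : 'X_{1..2}) : (m == m') = (m 0 == m' 0) && (m 1 == m' 1).
  apply/eqP/andP => [-> // | [/eqP e0 /eqP e1]]; apply/mnmP => i.
  by case: i => [[|[|//]] lt_i];
     [rewrite (_ : Ordinal _ = 0) | rewrite (_ : Ordinal _ = 1)] => //;
     apply/val_inj.
have WE a b c d m : (Wpoly a b c d)@_m =
    a * ((2%N == m 0) && (0%N == m 1))%:R + b * ((1%N == m 0) && (0%N == m 1))%:R
    + c * ((0%N == m 0) && (1%N == m 1))%:R + d * ((m 0 == 0%N) && (m 1 == 0%N))%:R.
  by rewrite !mcoeffD !mcoeffZ mcoeffXn !mcoeffX mcoeffC !mE !mulmnE !mnm1E !mnm0E.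
split.
- by have := coefW (U_(0%R) *+ 2)%MM;
     rewrite !WE !mulmnE !mnm1E /= !mulr0 !mulr1 !addr0.
- by have := coefW U_(0%R)%MM; rewrite !WE !mnm1E /= !mulr0 !mulr1 !addr0 !add0r.
- by have := coefW U_(1%R)%MM; rewrite !WE !mnm1E /= !mulr0 !mulr1 !addr0 !add0r.
- by have := coefW 0%MM; rewrite !WE !mnm0E /= !mulr0 !mulr1 !add0r.
Qed.

Definition in_W (f : {mpoly F[2]}) : Prop :=
  exists a11 a13 a23 a33, f = Wpoly a11 a13 a23 a33.

Lemma in_W0 : in_W 0.
Proof.
by exists 0, 0, 0, 0; rewrite /Wpoly !scale0r mpolyC0 !addr0.
Qed.

Lemma in_WP (a : F) f g : in_W f -> in_W g -> in_W (a *: f + g).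
Proof.
move=> [a11 [a13 [a23 [a33 ->]]]] [b11 [b13 [b23 [b33 ->]]]].
by rewrite Wpoly_lin; do 4!eexists.
Qed.

Lemma in_W_deg f : in_W f -> (msize f <= 3)%N.
Proof.
move=> [a11 [a13 [a23 [a33 ->]]]]; rewrite /Wpoly.
have leD (p r : {mpoly F[2]}) :
    (msize p <= 3)%N -> (msize r <= 3)%N -> (msize (p + r) <= 3)%N.
  by move=> hp hr; apply: leq_trans (msizeD_le _ _) _; rewrite geq_max hp.
apply: (leD); [apply: (leD); [apply: (leD) | ] | ].
- by apply: leq_trans (msizeZ_le _ _) _; rewrite mpolyXn msizeX mdegMn mdeg1.
- by apply: leq_trans (msizeZ_le _ _) _; rewrite msizeX mdeg1.
- by apply: leq_trans (msizeZ_le _ _) _; rewrite msizeX mdeg1.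
- by rewrite msizeC; case: (_ != _).
Qed.

Definition Wspace : quadratic_space := QuadraticSpace in_W0 in_WP in_W_deg.

End DattaJohnsen.

(* Main.v *)
Require Import Defs.
From HB Require Import structures.
From mathcomp Require Import all_boot all_order all_algebra.
From mathcomp Require Import mpoly.
From mathcomp Require Import finfield ring zify.

Set Implicit Arguments.
Unset Strict Implicit.
Unset Printing Implicit Defensive.

Import GRing.Theory.

(** Evaluating [Wpoly a b c d] at the elementary symmetric functions of a
    point (x, y) gives [symform a b c d x y] = a(x + y)^2 + b(x + y) + cxy + d,
    and each class of distinguished points contains exactly two ordered pairs
    off the diagonal. So twice the weight of a word is q(q - 1) minus the
    number [ozeros a b c d] of ordered zeros of the form with x <> y
    ([weight_ozeros]), and everything reduces to listing the values of
    [ozeros].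

    In characteristic 2 put s = x + y, so that x <> y means s <> 0.

    If c = 0, the form depends on s only, and [ozeros] is q times the number
    of non-zero roots of a s^2 + b s + d, that is 0, q or 2q ([ozeros_c0]).

    If c <> 0, write d = c e^2, which is possible because squaring is
    bijective. For s <> 0 the substitution x = s u + e turns the form into
    s (s (a + c (u^2 + u)) + (b + c e)), so [ozeros] counts the pairs (s, u)
    with s <> 0 and s (a + c (u^2 + u)) = b + c e ([ozeros_factor]). Let K be
    the number of roots u of a + c (u^2 + u); it is 0 or 2, since the roots
    are stable under u |-> u + 1. If b + c e = 0, then u has to be one of
    these roots and s is free: the count is (q - 1) K. If b + c e <> 0, then
    every other u determines s: the count is q - K.

    All of 2q, 2(q - 1), q, q - 2 and 0 occur ([ozeros_realized]). A non-zero
    parameter vector has at most 2q < q(q - 1) zeros, hence a non-zero word: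
    the parametrization is injective, which gives dimension 4, and the minimum
    distance is the least of the weights. *)

Section Lemmas.
Local Open Scope ring_scope.

(** * Ordered zeros and weights *)

Lemma card_fibers (T U : finType) (P : T -> U -> bool) :
  #|[set z : T * U | P z.1 z.2]| = (\sum_u #|[set t | P t u]|)%N.
Proof.
rewrite -sum1dep_card -(pair_big_dep xpredT P (fun _ _ => 1%N)) /=.
rewrite (exchange_big_dep xpredT) //=; apply: eq_bigr => u _.
by rewrite -sum1dep_card.
Qed.

Definition symform (F : finFieldType) (a b c d x y : F) : F :=
  a * (x + y) ^+ 2 + b * (x + y) + c * (x * y) + d.

Lemma symformC (F : finFieldType) (a b c d x y : F) :
  symform a b c d x y = symform a b c d y x.
Proof. by rewrite /symform; ring. Qed.

(** Ordered pairs, rather than classes, are counted: they form a subset of a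
    product, on which linear changes of variables act. *)
Definition ozeros (F : finFieldType) (a b c d : F) : nat :=
  #|[set z : F * F | (z.1 != z.2) && (symform a b c d z.1 z.2 == 0)]|.

Section Representatives.
Variables (F : finFieldType) (n : nat) (Q : n.-tuple (point F)).
Hypothesis hQ : is_representatives Q.

(** An index i and a bit, choosing one of the two orders of the coordinates of
    the i-th representative, determine a pair off the diagonal; this is a
    bijection because every distinguished point is equivalent to exactly one
    representative. *)
Lemma card_representatives (p : F -> F -> bool) :
  (forall x y, p x y = p y x) ->
  (#|[set i | p (tnth (tnth Q i) 0%R) (tnth (tnth Q i) 1%R)]| * 2)%N =
  #|[set z : F * F | (z.1 != z.2) && p z.1 z.2]|.
Proof.
move=> pC; case: hQ => hD hU.
pose fst i := tnth (tnth Q i) 0%R; pose snd i := tnth (tnth Q i) 1%R.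
have permE (x y : F) i :
    perm_eq [tuple x; y] (tnth Q i) =
    ((x, y) == (fst i, snd i)) || ((x, y) == (snd i, fst i)).
  have -> : tval (tnth Q i) = [:: fst i; snd i].
    rewrite /fst /snd; case: (tnth Q i) => [[|u [|v [|]]] //= hs].
  have small (u v : F) : perm_eq [:: u] [:: v] -> u = v.
    by move=> /perm_small_eq -/(_ isT) [].
  apply/idP/orP => [h | [] /eqP [-> ->] //]; last first.
    by rewrite (permPr (permEl (perm_catC [:: fst i] [:: snd i]))).
  have := perm_mem h x; rewrite !inE eqxx /= => /esym/orP [] /eqP e; subst x.
    by left; move: h; rewrite perm_cons => /small ->.
  right; move: h; rewrite (permPr (permEl (perm_catC [:: fst i] [:: snd i]))).
  by rewrite perm_cons => /small ->.
pose h (t : 'I_n * bool) :=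
  if t.2 then (snd t.1, fst t.1) else (fst t.1, snd t.1).
have hinj : injective h.
  move=> [i b] [j b']; have nj := hD j.
  have ij : h (i, b) = h (j, b') -> i = j.
    have dj : distinguished [tuple fst j; snd j].
      by rewrite /distinguished !(tnth_nth (fst j)).
    have [k [_ kU]] := hU _ dj.
    move=> e; have <- : k = i.
      apply: kU; rewrite permE !xpair_eqE; move: e; rewrite /h /=.
      by case: b b' => [] [] [-> ->]; rewrite !eqxx ?orbT.
    by apply: kU; rewrite permE eqxx.
  move=> e; have eij := ij e; move: e; clear ij; rewrite eij /h /=.
  move: nj; rewrite /distinguished -/(fst j) -/(snd j).
  by case: b b' => [] [] // /eqP ne [] e; case: ne.
have -> : (#|[set i | p (tnth (tnth Q i) 0%R) (tnth (tnth Q i) 1%R)]| * 2)%N =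
          #|setX [set i | p (fst i) (snd i)] [set: bool]|.
  by rewrite cardsX cardsT card_bool.
rewrite -(card_imset _ hinj); apply: eq_card => -[x y]; rewrite !inE /=.
apply/imsetP/andP => [[[i b]] | [neq pxy]].
  have := hD i; rewrite /distinguished -/(fst i) -/(snd i) !inE /= andbT.
  by case: b => ne pi [-> ->]; rewrite // eq_sym pC.
have dxy : distinguished [tuple x; y] by rewrite /distinguished !(tnth_nth x).
have [i [pi _]] := hU _ dxy; move: pi; rewrite permE => /orP [] /eqP e.
  by exists (i, false); rewrite // !inE andbT /=; case: e => <- <-.
by exists (i, true); rewrite // !inE andbT /=; case: e => <- <-; rewrite pC.
Qed.

Lemma card_offdiag : #|[set z : F * F | z.1 != z.2]| = (#|F| * (#|F| - 1))%N.
Proof.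
rewrite (@card_fibers _ _ (fun x y : F => x != y)).
rewrite (eq_bigr (fun _ => (#|F| - 1)%N)) ?sum_nat_const // => y _.
by rewrite subn1 -(cardsC1 y); apply: eq_card => x; rewrite !inE.
Qed.

Lemma size_representatives : (n * 2 = #|F| * (#|F| - 1))%N.
Proof.
rewrite -card_offdiag -[n in LHS]card_ord -cardsT.
have -> : [set z : F * F | z.1 != z.2] = [set z | (z.1 != z.2) && true].
  by apply/setP => z; rewrite !inE andbT.
by rewrite -(@card_representatives (fun _ _ => true)).
Qed.

Lemma eval_word_Wpoly (a b c d : F) i :
  eval_word Q (Wpoly a b c d) 0 i =
  symform a b c d (tnth (tnth Q i) 0) (tnth (tnth Q i) 1).
Proof.
rewrite mxE /Phi2 comp_mpoly_meval /Wpoly /symform.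
rewrite expr2 !mevalD !mevalZ mevalC mevalM !mevalXU /=.
by rewrite !(tnth_nth 0) /= mevalD mevalM !mevalXU !(tnth_nth 0).
Qed.

Lemma weight_ozeros (a b c d : F) :
  (weight (eval_word Q (Wpoly a b c d)) * 2 + ozeros a b c d = n * 2)%N.
Proof.
rewrite size_representatives -card_offdiag.
have -> : weight (eval_word Q (Wpoly a b c d)) =
    #|[set i | symform a b c d (tnth (tnth Q i) 0) (tnth (tnth Q i) 1) != 0]|.
  by apply: eq_card => i; rewrite !inE eval_word_Wpoly.
rewrite (@card_representatives (fun x y => symform a b c d x y != 0)); last first.
  by move=> x y; rewrite symformC.
rewrite /ozeros -(cardsID [set z : F * F | symform a b c d z.1 z.2 != 0]
                         [set z : F * F | z.1 != z.2]).
by congr (_ + _)%N; apply: eq_card => z; rewrite !inE ?negbK // andbC.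
Qed.

End Representatives.

(** * Values of the number of ordered zeros in characteristic 2 *)

Section CharTwo.
Variable F : finFieldType.
Hypothesis F2 : 2%N \in [pchar F].

Lemma ozeros_shear (a b c d : F) :
  ozeros a b c d =
  (\sum_(s : F | (s != 0)%R) #|[set x | (symform a b c d x (x + s) == 0)%R]|)%N.
Proof.
pose h (z : F * F) := (z.1, z.1 + z.2).
have hinj : injective h.
  by move=> [x y] [x' y'] [-> /addrI ->].
rewrite /ozeros -(card_preimset _ hinj).
have -> : h @^-1: [set z | (z.1 != z.2) && (symform a b c d z.1 z.2 == 0)] =
   [set z | (z.2 != 0) && (symform a b c d z.1 (z.1 + z.2) == 0)].
  apply/setP => -[x s]; rewrite !inE /= -{1}[x]addr0.
  by rewrite (inj_eq (addrI x)) eq_sym.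
rewrite (@card_fibers _ _ (fun x s => (s != 0) && (symform a b c d x (x + s) == 0))).
rewrite [RHS]big_mkcond /=; apply: eq_bigr => s _; case: ifP => _ //.
by apply: eq_card0 => x; rewrite !inE.
Qed.

Lemma ozeros_c0 (a b d : F) :
  ozeros a b 0 d =
  (#|F| * #|[set s : F | (s != 0)%R && (a * s ^+ 2 + b * s + d == 0)%R]|)%N.
Proof.
rewrite ozeros_shear mulnC -sum_nat_const big_mkcond [RHS]big_mkcond /=.
apply: eq_bigr => s _; rewrite !inE; case: (s != 0) => //=.
have fE x : symform a b 0 d x (x + s) = a * s ^+ 2 + b * s + d.
  by rewrite /symform mul0r addr0 addKr_pchar2.
case: ifP => h; [rewrite -cardsT | rewrite -[RHS](cards0 F)];
  by apply: eq_card => x; rewrite !inE fE h.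
Qed.

(** For c <> 0, the size of the fibre of the Artin-Schreier map
    u |-> u^2 + u over a / c. *)
Definition nroots (a c : F) : nat := #|[set u : F | a + c * (u ^+ 2 + u) == 0]|.

(** The substitution x = s u + e in the form at (x, x + s): writing the
    constant term as c e^2 makes it cancel, so a factor s splits off. *)
Lemma ozeros_factor (a b c e : F) :
  ozeros a b c (c * e ^+ 2) =
  (\sum_(s : F | (s != 0)%R)
    #|[set u | (s * (a + c * (u ^+ 2 + u)) == b + c * e)%R]|)%N.
Proof.
rewrite ozeros_shear; apply: eq_bigr => s s0.
pose h u := s * u + e.
have hinj : injective h by move=> u v /addIr /(mulfI s0).
rewrite -(card_preimset _ hinj); apply: eq_card => u; rewrite !inE /symform /h.
rewrite addKr_pchar2 //.
have -> : a * s ^+ 2 + b * s + c * ((s * u + e) * (s * u + e + s)) + c * e ^+ 2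
  = s * (s * (a + c * (u ^+ 2 + u)) + (b + c * e)) 
   + (c * e ^+ 2 + c * s * u * e) *+ 2 by ring.
rewrite mulr2n addrr_pchar2 // addr0 mulf_eq0 (negPf s0) /=.
by rewrite -[b + c * e in LHS](oppr_pchar2 F2) subr_eq0.
Qed.

Lemma ozeros_degenerate (a b c e : F) : b + c * e = 0 ->
  ozeros a b c (c * e ^+ 2)%R = ((#|F| - 1) * nroots a c)%N.
Proof.
move=> g0; rewrite ozeros_factor g0.
rewrite (eq_bigr (fun _ => nroots a c)) => [|s s0]; last first.
  by apply: eq_card => u; rewrite !inE mulf_eq0 (negPf s0).
rewrite sum_nat_const; congr (_ * _)%N.
by rewrite subn1 -(cardC1 0); apply: eq_card.
Qed.

(** For each u outside the [nroots a c] roots, the only solution is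
    s = (b + c e) / (a + c (u^2 + u)), which is non-zero; a root u admits no
    solution s. *)
Lemma ozeros_nondegenerate (a b c e : F) : b + c * e != 0 ->
  (ozeros a b c (c * e ^+ 2)%R + nroots a c = #|F|)%N.
Proof.
move=> g0; rewrite ozeros_factor; set g := b + c * e in g0 *.
pose v u := a + c * (u ^+ 2 + u).
transitivity (#|~: [set u : F | v u == 0%R]| + nroots a c)%N; last first.
  by rewrite addnC /nroots cardsC.
congr (_ + _)%N; rewrite -sum1_card [RHS]big_mkcond.
under [LHS]eq_bigr => s _ do rewrite -sum1dep_card.
rewrite (exchange_big_dep xpredT) //= ; apply: eq_bigr => u _.
rewrite sum1dep_card -/(v u) !inE; case: (eqVneq (v u) 0) => [v0 | v0] /=.
  by apply: eq_card0 => s; rewrite !inE v0 mulr0 (eq_sym 0) (negPf g0) andbF.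
rewrite -(cards1 (g / v u)); apply: eq_card => s; rewrite !inE.
apply/andP/eqP => [[_ /eqP <-] | ->]; first by rewrite mulfK.
by rewrite divfK // mulf_neq0 ?invr_eq0.
Qed.

(** If w is a root, then a + c (u^2 + u) = c (u - w) (u - (w + 1)). *)
Lemma nroots_0or2 (a c : F) : c != 0 -> nroots a c = 0%N \/ nroots a c = 2%N.
Proof.
move=> c0; case: (set_0Vmem [set u : F | a + c * (u ^+ 2 + u) == 0]) => [e | [w]].
  by left; rewrite /nroots e cards0.
rewrite inE => /eqP hw; right.
rewrite -[RHS](_ : #|[set w; w + 1]| = 2%N); last first.
  by rewrite cards2 -{1}[w]addr0 (inj_eq (addrI w)) eq_sym oner_eq0.
apply: eq_card => u; rewrite !inE -[X in _ == X]hw (inj_eq (addrI a)).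
rewrite (inj_eq (mulfI c0)) -subr_eq0.
have -> : u ^+ 2 + u - (w ^+ 2 + w) = (u - w) * (u - (w + 1) + w *+ 2 + 1 *+ 2) by ring.
rewrite !mulr2n !addrr_pchar2 // !addr0 mulf_eq0.
by rewrite !subr_eq0.
Qed.

Lemma sqrt_pchar2 (x : F) : exists e, e ^+ 2 = x.
Proof.
have inj : injective (fun e : F => e ^+ 2).
  by move=> y z /eqP; rewrite eqf_sqr oppr_pchar2 // orbb => /eqP.
by exists (invF inj x); rewrite (f_invF inj).
Qed.

Lemma card_quadratic_roots (a b d : F) : (a, b, d) != (0, 0, 0) ->
  (#|[set s : F | (s != 0)%R && (a * s ^+ 2 + b * s + d == 0)%R]| <= 2)%N.
Proof.
move=> nz; pose p : {poly F} := Poly [:: d; b; a].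
have p0 : p != 0.
  apply: contraNneq nz => p0; rewrite !xpair_eqE.
  have pE i : [:: d; b; a]`_i = 0 by rewrite -coef_Poly -/p p0 coef0.
  by have := (pE 0%N, pE 1%N, pE 2%N) => /= -[[-> ->] ->]; rewrite !eqxx.
have sp : (size p <= 3)%N := size_Poly _.
rewrite -ltnS cardE; apply: leq_trans sp.
apply: max_poly_roots => //; last exact: enum_uniq.
apply/allP => s; rewrite mem_enum inE => /andP [_ /eqP h].
rewrite /root horner_Poly /= mul0r add0r mulrDl -mulrA -expr2.
by rewrite h.
Qed.

Lemma ozeros_values (a b c d : F) : (a, b, c, d) != (0, 0, 0, 0) ->
  ozeros a b c d \in
  [:: (2 * #|F|)%N; (2 * (#|F| - 1))%N; #|F|; (#|F| - 2)%N; 0%N].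
Proof.
move=> nz; have [c0 | c0] := eqVneq c 0.
  rewrite c0 ozeros_c0; move: nz; rewrite c0 => nz.
  have := @card_quadratic_roots a b d; move: #|[set s | _]| => k hk.
  have : (k <= 2)%N by apply: hk; apply: contraNneq nz => -[-> -> ->].
  rewrite !inE; case: k {hk} => [|[|[|//]]] _; rewrite ?muln0 ?muln1 ?eqxx ?orbT //.
  by rewrite mulnC eqxx.
(* d = c e^2 *)
have [e he] := sqrt_pchar2 (c^-1 * d).
have <- : c * e ^+ 2 = d by rewrite he mulVKf.
have [g0 | g0] := eqVneq (b + c * e) 0.
  rewrite ozeros_degenerate //; case: (nroots_0or2 a c0) => ->.
    by rewrite muln0 !inE eqxx !orbT.
  by rewrite mulnC !inE eqxx !orbT.
have := ozeros_nondegenerate a g0.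
case: (nroots_0or2 a c0) => -> <-; rewrite ?addn0 ?addnK !inE eqxx !orbT //.
Qed.

(** Witnesses: s^2 + (1 + r) s + r with r outside {0, 1} for 2q (this needs a
    third field element), the product xy for 2(q - 1), s + 1 for q, s + xy for
    q - 2, and the constant 1 for 0. *)
Lemma ozeros_realized w : (4 <= #|F|)%N ->
  w \in [:: (2 * #|F|)%N; (2 * (#|F| - 1))%N; #|F|; (#|F| - 2)%N; 0%N] ->
  exists a b c d : F,
    (a, b, c, d) != (0, 0, 0, 0) /\ ozeros a b c d = w.
Proof.
move=> q4; have n1 : nroots 0 1 = 2%N.
  rewrite -[RHS](_ : #|[set 0; 1 : F]| = 2%N); last by rewrite cards2 eq_sym oner_eq0.
  apply: eq_card => u; rewrite !inE add0r mul1r.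
  have -> : u ^+ 2 + u = u * (u + 1) by ring.
  rewrite mulf_eq0.
  by rewrite addr_eq0 oppr_pchar2.
have nz (x y z t : F) : [|| x == 1, y == 1, z == 1 | t == 1] ->
    (x, y, z, t) != (0, 0, 0, 0).
  by move=> h; apply/eqP => -[e1 e2 e3 e4]; move: h;
     rewrite e1 e2 e3 e4 !(eq_sym 0) oner_eq0.
rewrite !inE => /or4P [/eqP -> | /eqP -> | /eqP -> | /orP [/eqP -> | /eqP ->]].
- have [r] : exists r : F, r \in ~: [set 0; 1].
    apply/set0Pn; rewrite -card_gt0 -(leq_add2l #|[set 0; 1 : F]|) cardsC addn1.
    by rewrite cards2 eq_sym oner_eq0; apply: leq_trans q4.
  rewrite !inE negb_or => /andP [r0 r1].
  (* s^2 + (1 + r) s + r = (s + 1) (s + r) *)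
  exists 1, (1 + r), 0, r; split; first by rewrite nz ?eqxx.
  rewrite ozeros_c0 mulnC; congr (_ * _)%N.
  rewrite -[RHS](_ : #|[set 1; r]| = 2%N); last by rewrite cards2 eq_sym r1.
  apply: eq_card => s; rewrite !inE.
  have -> : 1 * s ^+ 2 + (1 + r) * s + r = (s + 1) * (s + r) by ring.
  rewrite mulf_eq0 !addr_eq0 !oppr_pchar2 //.
  by case: (eqVneq s 0) => //= ->; rewrite !(eq_sym 0) oner_eq0 (negPf r0).
- exists 0, 0, 1, (1 * 0 ^+ 2); split; first by rewrite nz ?eqxx ?orbT.
  by rewrite ozeros_degenerate ?n1 1?mulnC // mulr0 addr0.
- exists 0, 1, 0, 1; split; first by rewrite nz ?eqxx ?orbT.
  rewrite ozeros_c0 -[RHS]muln1; congr (_ * _)%N.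
  rewrite -(cards1 (1 : F)); apply: eq_card => s; rewrite !inE.
  rewrite mul0r add0r mul1r addr_eq0 oppr_pchar2 //.
  by case: (eqVneq s 1) => [->|]; rewrite ?oner_eq0 ?andbF.
- exists 0, 1, 1, (1 * 0 ^+ 2); split; first by rewrite nz ?eqxx ?orbT.
  have := @ozeros_nondegenerate 0 1 1 0; rewrite n1 mulr0 addr0 oner_eq0.
  by move=> /(_ isT) <-; rewrite addnK.
exists 0, 0, 0, 1; split; first by rewrite nz ?eqxx ?orbT.
rewrite ozeros_c0 -[RHS](muln0 #|F|) -(cards0 F); congr (_ * _)%N.
by apply: eq_card => s; rewrite !inE !mul0r !add0r oner_eq0 andbF.
Qed.

End CharTwo.

(** * The code as the image of a linear map *)

(** Since q is even, the truncated divisions of the five expected weights are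
    exact; each weight is n minus half of a value of [ozeros]. *)
Lemma expected_weights (q n : nat) : (exists m, q = 2 ^ m)%N -> (4 <= q)%N ->
  (n * 2 = q * (q - 1))%N ->
  [/\ (q * (q - 3) %/ 2 = n - q)%N,
      ((q ^ 2 - 3 * q + 2) %/ 2 = n - (q - 1))%N,
      (q ^ 2 %/ 2 - q = n - q %/ 2)%N,
      (q ^ 2 %/ 2 - q + 1 = n - (q - 2) %/ 2)%N
    & (q * (q - 1) %/ 2 = n)%N] /\ (2 * (q %/ 2) = q /\ q < n)%N.
Proof.
case=> [[|m]] -> //; rewrite expnS; move: (2 ^ m)%N => h q4 nE.
have {}nE : n = (h * (2 * h - 1))%N by lia.
have e1 : (2 * h * (2 * h - 3) = (n - 2 * h) * 2)%N by nia.
have e2 : ((2 * h) ^ 2 - 3 * (2 * h) + 2 = (n - (2 * h - 1)) * 2)%N by nia.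
have e3 : ((2 * h) ^ 2 = (2 * (h * h)) * 2)%N by nia.
have e4 : (2 * h * (2 * h - 1) = n * 2)%N by nia.
have e5 : (2 * h - 2 = (h - 1) * 2)%N by lia.
have e6 : (2 * h = h * 2)%N by lia.
rewrite e1 e2 e3 e4 e5 {3 5}e6 !mulnK //.
by split; [split=> //; nia | split; nia].
Qed.

Section Code.
Variables (F : finFieldType) (n : nat) (Q : n.-tuple (point F)).

(** The code is presented as the image of the coordinate space of W so that
    its dimension comes from the kernel of this linear map. *)
Definition param_word (u : 'rV[F]_4) : 'rV[F]_n :=
  eval_word Q (Wpoly (u 0 0) (u 0 1) (u 0 2%:R) (u 0 3%:R)).

Lemma param_wordE u i : param_word u 0 i =
  symform (u 0 0) (u 0 1) (u 0 2%:R) (u 0 3%:R)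
    (tnth (tnth Q i) 0) (tnth (tnth Q i) 1).
Proof. exact: eval_word_Wpoly. Qed.

Lemma param_word_linear : linear param_word.
Proof.
move=> k u v; apply/rowP => i.
by rewrite [RHS]mxE [X in _ = X + _]mxE !param_wordE !mxE /symform; ring.
Qed.

HB.instance Definition _ :=
  GRing.isLinear.Build F 'rV[F]_4 'rV[F]_n *:%R param_word param_word_linear.

Lemma row4P (u : 'rV[F]_4) :
  ((u 0 0, u 0 1, u 0 2%:R, u 0 3%:R) == (0, 0, 0, 0)) = (u == 0).
Proof.
apply/eqP/eqP => [[e0 e1 e2 e3] | ->]; last by rewrite !mxE.
apply/rowP => -[[|[|[|[|//]]]] lti]; rewrite mxE;
  [rewrite -[RHS]e0 | rewrite -[RHS]e1 | rewrite -[RHS]e2 | rewrite -[RHS]e3];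
  by congr (u 0 _); apply: val_inj.
Qed.

Lemma param_word_row (a b c d : F) :
  exists u, param_word u = eval_word Q (Wpoly a b c d) /\
    (u == 0) = ((a, b, c, d) == (0, 0, 0, 0)).
Proof.
exists (\row_i [:: a; b; c; d]`_i); split; last by rewrite -row4P !mxE.
by rewrite /param_word !mxE.
Qed.

Lemma reduced_DJ_codeP (c : 'rV[F]_n) :
  reduced_DJ_code (Wspace F) Q c <-> exists u, c = param_word u.
Proof.
split=> [[f [a [b [x [d ->]]]] ->] | [u ->]].
  by have [u [<- _]] := param_word_row a b x d; exists u.
by eexists; last reflexivity; do 4!eexists.
Qed.

Lemma hamming_dist_weight (c c' : 'rV[F]_n) : hamming_dist c c' = weight (c - c').
Proof. by apply: eq_card => i; rewrite !inE !mxE subr_eq0. Qed.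

End Code.

(** The weight w of a word and its number z of ordered zeros determine each
    other, so the two lists of values correspond. *)
Lemma weight_values (n q w z : nat) : (w * 2 + z = n * 2)%N ->
  (2 * (q %/ 2) = q)%N -> (4 <= q)%N -> (q < n)%N ->
  (w \in [:: n - q; n - (q - 1); n - q %/ 2; n - (q - 2) %/ 2; n]%N) =
  (z \in [:: 2 * q; 2 * (q - 1); q; q - 2; 0]%N).
Proof. by move=> e1 e2 e3 e4; rewrite !inE; lia. Qed.

End Lemmas.

Theorem mainTheorem5 (F : finFieldType) (q : nat) (hF : #|F| = q)
    (hq2 : exists m : nat, q = 2 ^ m) (hq4 : 4 <= q)
    (n : nat) (Q : n.-tuple (point F)) (hQ : is_representatives Q) :
  is_linear_code (reduced_DJ_code (Wspace F) Q)
    (q * (q - 1) %/ 2) 4 (q * (q - 3) %/ 2) /\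
  (forall w : nat,
     is_nonzero_weight (reduced_DJ_code (Wspace F) Q) w <->
     w \in [:: q * (q - 3) %/ 2; (q ^ 2 - 3 * q + 2) %/ 2;
              q ^ 2 %/ 2 - q; q ^ 2 %/ 2 - q + 1; q * (q - 1) %/ 2]).
Proof.
have F2 : (2%N \in [pchar F])%R.
  by case: hq2 => m hm; apply: (@card_finPcharP F 2 m) => //; rewrite hF.
have nE := size_representatives hQ; rewrite hF in nE.
have [[-> -> -> -> ->] [q_even lt_qn]] := expected_weights hq2 hq4 nE.
set L := [:: _; _; _; _; _].
have wtE (u : 'rV[F]_4) :=
  weight_ozeros hQ (u 0 0)%R (u 0 1)%R (u 0 2%:R)%R (u 0 3%:R)%R.
have wtL (u : 'rV[F]_4) : (u != 0)%R -> weight (param_word Q u) \in L.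
  rewrite -row4P => /(ozeros_values F2); rewrite hF => zu.
  by rewrite /L (weight_values (wtE u)).
(* n - q is the least of the five weights, and it is positive. *)
have wtL_ge w : w \in L -> n - q <= w by rewrite /L !inE; lia.
have param_neq0 u : (u != 0)%R -> (param_word Q u != 0)%R.
  move=> /wtL /wtL_ge; apply: contraTneq => ->.
  rewrite /weight (_ : [set i | _] = set0) ?cards0; first by lia.
  by apply/setP => i; rewrite !inE mxE eqxx.
have realize w : w \in L -> exists2 u, (u != 0)%R & weight (param_word Q u) = w.
  move=> wL; have le_wn : w <= n by move: wL; rewrite /L !inE; lia.
  have wz : w * 2 + (n - w) * 2 = n * 2 by lia.
  move: (wL); rewrite /L (weight_values wz) // -hF.
  case/(ozeros_realized F2); first by rewrite hF.
  move=> a [b [c [d [nz zE]]]]; have [u [uE u0]] := param_word_row Q a b c d.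
  exists u; first by rewrite u0.
  by have := weight_ozeros hQ a b c d; rewrite zE uE; lia.
split; last first.
  move=> w; split=> [[c [/reduced_DJ_codeP [u ->] /eqP nz <-]] | wL].
    by apply: wtL; apply: contraNneq nz => ->; rewrite linear0.
  have [u u0 <-] := realize w wL; exists (param_word Q u); split=> //.
    by apply/reduced_DJ_codeP; exists u.
  by apply/eqP; apply: param_neq0.
split=> //.
- exists (limg (linfun (param_word Q))); split.
    move=> c; rewrite reduced_DJ_codeP; split.
      by case/memv_imgP => u _ ->; exists u; rewrite lfunE.
    by case=> u ->; apply/memv_imgP; exists u; rewrite ?memvf // lfunE.
  rewrite limg_dim_eq ?dimvf ?dim_matrix //.
  apply/eqP; rewrite -subv0; apply/subvP => u; rewrite memv_cap memv_ker lfunE /=.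
  case/andP => _ /eqP e; rewrite memv0; apply: contraT => /param_neq0.
  by rewrite e eqxx.
split.
  have [u u0 wu] := realize (n - q) (mem_head _ _).
  exists (param_word Q u), 0%R; split.
  - by apply/reduced_DJ_codeP; exists u.
  - by apply/reduced_DJ_codeP; exists 0%R; rewrite linear0.
  - by apply/eqP; apply: param_neq0.
  by rewrite hamming_dist_weight subr0.
move=> _ _ /reduced_DJ_codeP [u ->] /reduced_DJ_codeP [v ->] /eqP neq.
rewrite hamming_dist_weight -linearB; apply/wtL_ge/wtL.
by rewrite subr_eq0; apply: contraNneq neq => ->.
Qed.
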